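(* Let $\Gamma$ be an infinite group generated by the finite symmetric set $S$ and let $H_n\leq\Gamma$ be a sequence of subgroups of finite index with $|\Gamma:H_n|\rightarrow\infty$. Then $$\liminf_{n\to\infty}\rho_0(\mathrm{Sch}(\Gamma/H_n,S))\geq\rho(\mathrm{Cay}(\Gamma,S)).$$
   Context: A subset $S\subseteq\Gamma$ is symmetric if $s\in S$ implies $s^{-1}\in S$. For a subgroup $H\le\Gamma$, the Schreier graph $\mathrm{Sch}(\Gamma/H,S)$ has vertex set the set of right cosets $\Gamma/H=\{Hg\mid g\in\Gamma\}$, and for each $s\in S$ and each vertex $Hg$ an $s$-labeled edge from $Hg$ to $Hgs$ (loops and multiple edges allowed); the $s$-labeled edges are inverses of the $s^{-1}$-labeled edges. $\mathrm{Cay}(\Gamma,S)$ is the Schreier graph for $H=1$. The Markov operator $M$ on $\ell^2$ of the vertex set is $(Mf)(x)=\frac{1}{|S|}\sum_{s\in S}f(xs)$; the spectral radius $\rho$ of the graph is the operator norm of $M$. For a finite Schreier graph, $\rho_0$ denotes the norm of $M$ restricted to $\ell^2_0$, the space of vectors with zero sum. *)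

(* Defs.v *)
From HB Require Import structures.
From mathcomp Require Import all_boot all_order all_algebra finmap.
From mathcomp Require Import all_classical all_reals ereal exp esum.
From mathcomp Require Import topology sequences.

Set Implicit Arguments.
Unset Strict Implicit.
Unset Printing Implicit Defensive.

Import Order.TTheory GRing.Theory Num.Theory.

Local Open Scope classical_set_scope.
Local Open Scope ring_scope.

Section Cosets.
Context {G : groupType}.
Implicit Types (H : set G) (g s : G).

Definition subgroup H : Prop := group_closed (mem H).

Definition symmetric_set (S : {fset G}) : Prop :=
  forall s, s \in S -> (s^-1)%g \in S.

Definition generated_by (S : {fset G}) : Prop :=
  smallest subgroup [set` S] = [set: G].

Definition rtranslate (A : set G) g : set G := [set (a * g)%g | a in A].

Definition right_cosets H : set (set G) := range (rtranslate H).

Definition finite_index H : Prop := finite_set (right_cosets H).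

Definition subgroup_index H : nat := #|` fset_set (right_cosets H)|.

End Cosets.

(* [target x s] is the endpoint of the unique [s]-labelled edge leaving [x];  *)
(* loops and multiple edges are allowed.                                      *)
Record labelled_graph (L : choiceType) := LabelledGraph {
  vertex : choiceType;
  labels : {fset L};
  target : vertex -> L -> vertex }.

Section Schreier.
Context {G : groupType}.
Implicit Types (H : set G) (S : {fset G}).

Fact rtranslate_right_cosets H (x : right_cosets H) (s : G) :
  rtranslate (val x) s \in right_cosets H.
Proof.
case: x => A /= /set_mem[g _ <-]; apply/mem_set; exists (g * s)%g => //.
apply/seteqP; split => [_ [h Hh <-]|_ [_ [h Hh <-] <-]].
  by exists (h * g)%g; [exists h | rewrite mulgA].
by exists h => //; rewrite mulgA.
Qed.

Definition coset_step H (x : right_cosets H) (s : G) : right_cosets H :=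
  exist _ (rtranslate (val x) s) (rtranslate_right_cosets x s).

Lemma coset_stepK H (x : right_cosets H) (s : G) :
  coset_step (coset_step x s) (s^-1)%g = x.
Proof.
apply/val_inj/seteqP; split => [_ [_ [a xa <-] <-]|a xa] /=.
  by rewrite mulgK.
by exists (a * s)%g; [exists a | rewrite mulgK].
Qed.

Definition Sch H S : labelled_graph G := LabelledGraph S (@coset_step H).

Definition Cay S : labelled_graph G := Sch [set 1%g] S.

End Schreier.

Section Spectral.
Variable R : realType.

(* Functions are real-valued: [markov] below has real coefficients, so its norm *)
(* is the same on real and on complex l2. [l2norm f] is +oo for [f] not in l2.  *)
Definition l2norm (V : choiceType) (f : V -> R) : \bar R :=
  ((\esum_(x in [set: V]) ((f x) ^+ 2)%:E) `^ 2^-1)%E.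

Definition l2 (V : choiceType) : set (V -> R) := [set f | (l2norm f < +oo)%E].

(* Meant for finite [V]: \sum_(x \in _) is 0 on infinitely supported [f]. *)
Definition l2_0 (V : choiceType) : set (V -> R) :=
  [set f | l2 f /\ \sum_(x \in [set: V]) f x = 0].

Definition opnorm (V : choiceType) (E : set (V -> R))
    (T : (V -> R) -> (V -> R)) : \bar R :=
  ereal_sup [set l2norm (T f) | f in [set f | E f /\ (l2norm f <= 1)%E]].

Definition markov (L : choiceType) (X : labelled_graph L)
    (f : vertex X -> R) : vertex X -> R :=
  fun x => #|` labels X|%:R^-1 * \sum_(s <- labels X) f (target x s).

Definition rho (L : choiceType) (X : labelled_graph L) : \bar R :=
  opnorm (@l2 (vertex X)) (@markov L X).

Definition rho0 (L : choiceType) (X : labelled_graph L) : \bar R :=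
  opnorm (@l2_0 (vertex X)) (@markov L X).

End Spectral.

(* Main.v *)
(* Let p_j be the probability that the random walk on Cay returns to its       *)
(* origin after 2j steps. Cay covers every Schreier graph, with any vertex     *)
(* lying over any other, so all return probabilities of Schreier graphs are at *)
(* least p_j. If Sch has two vertices x, y with no path of length 2j between   *)
(* them, which holds as soon as the index is large, then v = d_x - d_y has     *)
(* zero sum, |v|^2 = 2 and |M^j v|^2 >= 2 p_j; hence rho_0 >= p_j^(1/2j).      *)
(* Conversely, if p_j <= c^(2j) for all j, then on Cay |M^j f|^2 is            *)
(* O(c^(2j)) for finitely supported f, and log-convexity in j of |M^j f|^2     *)
(* yields |M f| <= c |f|; thus rho(Cay) <= c.                                  *)

Require Import Defs.
From mathcomp Require Import all_boot all_order all_algebra finmap.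
From mathcomp Require Import all_classical all_reals ereal exp esum.
From mathcomp Require Import topology sequences.
From mathcomp Require Import ring lra.

Import Order.TTheory GRing.Theory Num.Theory.

Local Open Scope classical_set_scope.
Local Open Scope ring_scope.

Set Implicit Arguments.
Unset Strict Implicit.
Unset Printing Implicit Defensive.

(** The argument runs through a fixed real c above the liminf. For each j some n has both [rho0]
    below c and an index too large for walks of length 2j, so [iter_markov_delta_rho0] finds a
    vertex whose return probability after 2j steps is at most c^(2j). By [exists_covering] and
    [iter_markov_delta_cover] this bound passes to every vertex of the Cayley graph. The index n
    varies with j but c does not, so [rho_le_of_return] bounds the spectral radius by c. All
    spectral estimates are made on finitely supported functions, and [rho_le] extends them to l2. *)

Lemma sqr_sum_le (R : realFieldType) (I : Type) (r : seq I) (F G : I -> R) :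
  (\sum_(i <- r) F i * G i) ^+ 2 <=
  (\sum_(i <- r) F i * F i) * (\sum_(i <- r) G i * G i).
Proof.
have : 0 <= \sum_(i <- r) \sum_(j <- r) (F i * G j - F j * G i) ^+ 2.
  by apply: sumr_ge0 => i _; apply: sumr_ge0 => j _; exact: sqr_ge0.
(* Lagrange's identity *)
have -> : \sum_(i <- r) \sum_(j <- r) (F i * G j - F j * G i) ^+ 2 =
  \sum_(i <- r) \sum_(j <- r) (F i * F i) * (G j * G j) +
  (\sum_(i <- r) \sum_(j <- r) (G i * G i) * (F j * F j) -
   2 * \sum_(i <- r) \sum_(j <- r) (F i * G i) * (F j * G j)).
  rewrite mulr_sumr -sumrB -big_split /=; apply: eq_bigr => i _.
  rewrite mulr_sumr -sumrB -big_split /=; apply: eq_bigr => j _; ring.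
have dist (f g : I -> R) : \sum_(i <- r) \sum_(j <- r) f i * g j =
    (\sum_(i <- r) f i) * (\sum_(j <- r) g j).
  by rewrite mulr_suml; apply: eq_bigr => i _; rewrite mulr_sumr.
rewrite !dist; lra.
Qed.

(** If x > q > 0, Bernoulli's inequality makes (x / q)^j grow at least linearly, hence past C. This
    removes multiplicative constants from exponential bounds. *)
Lemma le_of_exp_le (R : realType) (C x q : R) : 0 <= C -> 0 <= q ->
  (forall j, x ^+ j <= C * q ^+ j) -> x <= q.
Proof.
move=> C0 q0 xq; rewrite leNgt; apply/negP => qx.
have [q_eq0|q_neq0] := eqVneq q 0.
  by have := xq 1%N; rewrite q_eq0 !expr1 mulr0 leNgt -q_eq0 qx.
have q_gt0 : 0 < q by rewrite lt_def q_neq0.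
set t := x / q - 1; have t0 : 0 < t.
  by rewrite subr_gt0 ltr_pdivlMr ?mul1r.
have bern j : 1 + t *+ j <= (1 + t) ^+ j.
  elim: j => [|j IHj]; first by rewrite mulr0n addr0 expr0.
  rewrite exprS; apply: le_trans (ler_wpM2l _ IHj); last by lra.
  rewrite mulrS mulrDl mul1r mulrDr mulr1.
  have : 0 <= t * (t *+ j) by rewrite mulr_ge0 ?mulrn_wge0// ltW.
  lra.
have [j Cj] : exists j, C < t *+ j.
  exists (Num.bound (C / t)); rewrite -mulr_natr mulrC -ltr_pdivrMr//.
  by apply: le_lt_trans (archi_boundP _) => //; rewrite divr_ge0// ltW.
have := xq j; rewrite leNgt => /negP; apply.
rewrite -ltr_pdivlMr ?exprn_gt0// -expr_div_n.
apply: lt_le_trans (_ : 1 + t *+ j <= _); first by lra.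
by apply: le_trans (bern j) _; rewrite /t addrC subrK.
Qed.

(** The ratios of consecutive terms do not decrease, so each is at least a 1 / a 0, and their
    product is a j / a 0. Everything is cross-multiplied because terms may vanish. *)
Lemma log_convex_exp_le (R : realFieldType) (a : nat -> R) :
  (forall j, 0 <= a j) -> (forall j, a j.+1 ^+ 2 <= a j * a j.+2) ->
  forall j, a 1%N ^+ j * a 0%N <= a j * a 0%N ^+ j.
Proof.
move=> a0 alc.
have ratio j : a 1%N * a j <= a 0%N * a j.+1.
  elim: j => [|j IHj]; first by rewrite mulrC.
  have [->|neq0] := eqVneq (a j.+1) 0; first by rewrite mulr0 mulr_ge0.
  rewrite -(@ler_pM2l _ (a j.+1)); last by rewrite lt_def neq0 a0.
  apply: le_trans (_ : a 1%N * (a j * a j.+2) <= _).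
    by rewrite mulrCA ler_wpM2l// -expr2.
  by rewrite !mulrA [a j.+1 * _]mulrC ler_wpM2r.
elim=> [|j IHj]; first by rewrite !expr0 mul1r mulr1.
rewrite exprS -mulrA.
apply: le_trans (ler_wpM2l (a0 1%N) IHj) _.
by rewrite mulrA exprS mulrA [a j.+1 * _]mulrC ler_wpM2r ?exprn_ge0.
Qed.

(** * Finitely supported functions and their inner product *)

Section FiniteSupport.
Variables (R : realType) (V : choiceType).
Implicit Types (f g h : V -> R) (A B : {fset V}).

Definition supported A f := forall x, x \notin A -> f x = 0.

Definition finsupp_fun f := exists A, supported A f.

(** This sum is 0 by default on infinite supports; additivity therefore needs [finsupp_fun], while
    scaling and reindexing do not. *)
Definition fsum f : R := \sum_(x \in [set: V]) f x.

Definition dot f g : R := fsum (fun x => f x * g x).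

Lemma supportedW A B f : (A `<=` B)%fset -> supported A f -> supported B f.
Proof. by move=> /fsubsetP AB fA x xB; apply: fA; apply: contraNN xB => /AB. Qed.

Lemma finsuppD f g :
  finsupp_fun f -> finsupp_fun g -> finsupp_fun (fun x => f x + g x).
Proof.
move=> [A fA] [B gB]; exists (A `|` B)%fset => x.
by rewrite in_fsetU negb_or => /andP[/fA-> /gB->]; rewrite addr0.
Qed.

Lemma finsuppMl f g : finsupp_fun f -> finsupp_fun (fun x => f x * g x).
Proof. by move=> [A fA]; exists A => x /fA->; rewrite mul0r. Qed.

Lemma finsuppMr f g : finsupp_fun g -> finsupp_fun (fun x => f x * g x).
Proof. by move=> [A fA]; exists A => x /fA->; rewrite mulr0. Qed.

Lemma finsupp_sum (I : Type) (r : seq I) (F : I -> V -> R) :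
  (forall i, finsupp_fun (F i)) -> finsupp_fun (fun x => \sum_(i <- r) F i x).
Proof.
move=> FI; elim: r => [|i r IHr].
  by exists fset0 => x _; rewrite big_nil.
have [A hA] := finsuppD (FI i) IHr.
by exists A => x /hA; rewrite big_cons.
Qed.

Lemma fsumE A f : supported A f -> fsum f = \sum_(x <- A) f x.
Proof. by move=> fA; exact: fsbigTE. Qed.

Lemma fsumD f g : finsupp_fun f -> finsupp_fun g ->
  fsum (fun x => f x + g x) = fsum f + fsum g.
Proof.
move=> [A fA] [B gB].
have fAB := supportedW (fsubsetUl A B) fA.
have gAB := supportedW (fsubsetUr A B) gB.
rewrite (fsumE fAB) (fsumE gAB) -big_split; apply: fsumE => x xAB.
by rewrite fAB// gAB// addr0.
Qed.

Lemma fsum_sum (I : Type) (r : seq I) (F : I -> V -> R) :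
  (forall i, finsupp_fun (F i)) ->
  fsum (fun x => \sum_(i <- r) F i x) = \sum_(i <- r) fsum (F i).
Proof.
move=> FI; elim: r => [|i r IHr].
  by rewrite big_nil /fsum fsbig1// => x _; rewrite big_nil.
rewrite big_cons -IHr -fsumD//; last exact: finsupp_sum.
by congr fsum; apply/funext => x; rewrite big_cons.
Qed.

Lemma fsumZ a f : fsum (fun x => a * f x) = a * fsum f.
Proof. by rewrite /fsum mulr_fsumr. Qed.

Lemma ler_fsum f g : finsupp_fun f -> finsupp_fun g ->
  (forall x, f x <= g x) -> fsum f <= fsum g.
Proof.
move=> [A fA] [B gB] fg.
rewrite (fsumE (supportedW (fsubsetUl A B) fA)).
rewrite (fsumE (supportedW (fsubsetUr A B) gB)).
exact: ler_sum.
Qed.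

Lemma dotE A f g : supported A f -> dot f g = \sum_(x <- A) f x * g x.
Proof. by move=> fA; apply: fsumE => x /fA->; rewrite mul0r. Qed.

Lemma dotC f g : dot f g = dot g f.
Proof. by rewrite /dot; congr fsum; apply/funext => x; rewrite mulrC. Qed.

Lemma dot_ge0 f : 0 <= dot f f.
Proof. by apply: fsumr_ge0 => x _; rewrite -expr2 sqr_ge0. Qed.

Lemma dot_eq0 f : finsupp_fun f -> dot f f = 0 -> f = fun=> 0.
Proof.
move=> [A fA]; rewrite (dotE _ fA) => /eqP; rewrite psumr_eq0; last first.
  by move=> x _; rewrite -expr2 sqr_ge0.
move=> /allP f0; apply/funext => x; have [/f0|/fA//] := boolP (x \in A).
by rewrite /= mulf_eq0 orbb => /eqP.
Qed.

Lemma dotZ a f : dot (fun x => a * f x) (fun x => a * f x) = a ^+ 2 * dot f f.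
Proof.
by rewrite /dot -fsumZ; congr fsum; apply/funext => x; rewrite mulrACA expr2.
Qed.

Lemma dotBl f g h : finsupp_fun f -> finsupp_fun g ->
  dot (fun x => f x - g x) h = dot f h - dot g h.
Proof.
move=> fF gF; rewrite -[- dot g h]mulN1r /dot -fsumZ -fsumD.
- by congr fsum; apply/funext => x; rewrite mulN1r mulrBl.
- exact: finsuppMl.
- by apply: finsuppMr; exact: finsuppMl.
Qed.

Lemma dot_CauchySchwarz f g : finsupp_fun f -> finsupp_fun g ->
  dot f g ^+ 2 <= dot f f * dot g g.
Proof.
move=> [A fA] [B gB].
have fAB := supportedW (fsubsetUl A B) fA.
have gAB := supportedW (fsubsetUr A B) gB.
rewrite !(dotE _ fAB) (dotE _ gAB); exact: sqr_sum_le.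
Qed.

Definition delta (a : V) : V -> R := fun x => (x == a)%:R.

Lemma supported_delta a : supported [fset a]%fset (delta a).
Proof. by move=> x; rewrite in_fset1 /delta => /negbTE->. Qed.

Lemma finsupp_delta a : finsupp_fun (delta a).
Proof. by exists [fset a]%fset; exact: supported_delta. Qed.

Lemma dot_delta a f : dot (delta a) f = f a.
Proof.
by rewrite (dotE _ (@supported_delta a)) big_seq_fset1 /delta eqxx mul1r.
Qed.

Lemma fsum_delta a : fsum (delta a) = 1.
Proof. by rewrite (fsumE (@supported_delta a)) big_seq_fset1 /delta eqxx. Qed.

(** Replaces the extended-real norm by finite partial sums, with no assumption that f lies in l2. *)
Lemma l2norm_leP f c : 0 <= c -> (l2norm f <= c%:E)%E <->
  forall A, \sum_(x <- A) f x ^+ 2 <= c ^+ 2.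
Proof.
move=> c0; have e0 : (0 <= \esum_(x in [set: V]) (f x ^+ 2)%:E)%E.
  by apply: esum_ge0 => x _; rewrite lee_fin sqr_ge0.
have -> : (l2norm f <= c%:E)%E =
    (\esum_(x in [set: V]) (f x ^+ 2)%:E <= (c ^+ 2)%:E)%E.
  rewrite /l2norm poweR12_sqrt// -(@lee_sqrt _ _ (c ^+ 2)%:E) ?lee_fin ?sqr_ge0//.
  by rewrite /= sqrtr_sqr ger0_norm.
split=> [fc A|fc].
  rewrite -lee_fin; apply: le_trans fc; apply: esum_ge; exists [set` A].
    by split => //; exact: finite_fset.
  by rewrite -fsbig_seq// sumEFin.
apply: ge_ereal_sup => _ [X [Xfin _] <-].
by rewrite fsbig_finite//= sumEFin lee_fin.
Qed.

Lemma l2norm_finsupp_leP f c : 0 <= c -> finsupp_fun f ->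
  (l2norm f <= c%:E)%E <-> dot f f <= c ^+ 2.
Proof.
move=> c0 [A fA]; split=> [/(l2norm_leP f c0)/(_ A)|fc].
  by rewrite (dotE _ fA); under eq_bigr do rewrite expr2.
apply/(l2norm_leP f c0) => B; apply: le_trans fc.
have fAB := supportedW (fsubsetUr B A) fA.
rewrite (dotE _ fAB); under [leRHS]eq_bigr do rewrite -expr2.
rewrite [leRHS](big_fsetID _ (fun x => x \in B)) /=.
have -> : [fset x in (B `|` A)%fset | x \in B]%fset = B.
  by apply/fsetP => x; rewrite !inE /=; case: (x \in B); rewrite ?andbF.
by rewrite lerDl sumr_ge0// => x _; exact: sqr_ge0.
Qed.

End FiniteSupport.

(** * The Markov operator of a Schreier graph *)

Section SchreierGraph.
Variables (R : realType) (G : groupType) (S : {fset G}) (H : set G).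
Local Notation V := (vertex (Sch H S)).
Local Notation M := (@markov R G (Sch H S)).
Implicit Types (x y : V) (f g : V -> R) (A : {fset V}).

Lemma coset_stepVK (x : right_cosets H) (s : G) :
  coset_step (coset_step x (s^-1)%g) s = x.
Proof. by rewrite -{2}[s]invgK coset_stepK. Qed.

Lemma coset_step_bij (s : G) : bijective (fun x : right_cosets H => coset_step x s).
Proof.
exists (fun x => coset_step x (s^-1)%g) => x; first exact: coset_stepK.
exact: coset_stepVK.
Qed.

Lemma finsupp_step f (s : G) :
  finsupp_fun f -> finsupp_fun (fun x => f (coset_step x s)).
Proof.
move=> [A fA]; exists [fset coset_step x (s^-1)%g | x in A]%fset => x xA.
apply: fA; apply: contraNN xA => xA; apply/imfsetP; exists (coset_step x s) => //.
by rewrite coset_stepK.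
Qed.

Lemma fsum_step f (s : G) : fsum (fun x => f (coset_step x s)) = fsum f.
Proof. by apply/esym/reindex_fsbigT; exact: coset_step_bij. Qed.

Lemma finsupp_markov f : finsupp_fun f -> finsupp_fun (M f).
Proof.
move=> fF; apply: finsuppMr; apply: finsupp_sum => s; exact: finsupp_step.
Qed.

Lemma finsupp_iter_markov j f : finsupp_fun f -> finsupp_fun (iter j M f).
Proof. by move=> fF; elim: j => //= j; exact: finsupp_markov. Qed.

Lemma fsum_markov_eq0 f : finsupp_fun f -> fsum f = 0 -> fsum (M f) = 0.
Proof.
move=> fF f0; rewrite /markov fsumZ fsum_sum => [|s]; last exact: finsupp_step.
by rewrite big1 ?mulr0// => s _; rewrite fsum_step.
Qed.

Lemma markov0 : M (fun=> 0) = fun=> 0.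
Proof. by apply/funext => x; rewrite /markov big1 ?mulr0. Qed.

Lemma markovB f g : M (fun x => f x - g x) = fun x => M f x - M g x.
Proof. by apply/funext => x; rewrite /markov -mulrBr -sumrB. Qed.

Lemma iter_markovB j f g :
  iter j M (fun x => f x - g x) = fun x => iter j M f x - iter j M g x.
Proof. by elim: j => //= j ->; rewrite markovB. Qed.

Lemma markov_sum (I : Type) (r : seq I) (F : I -> V -> R) :
  M (fun x => \sum_(i <- r) F i x) = fun x => \sum_(i <- r) M (F i) x.
Proof.
apply/funext => x; rewrite /markov -mulr_sumr; congr (_ * _).
by rewrite exchange_big.
Qed.

Lemma markovZ a f : M (fun x => a * f x) = fun x => a * M f x.
Proof. by apply/funext => x; rewrite /markov -mulr_sumr mulrCA. Qed.

(** The operator norm only tests the unit ball, so f is rescaled by 1 / |f|; the case f = 0 is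
    separate. *)
Lemma markov_l2_0_le c f : 0 <= c -> (rho0 R (Sch H S) <= c%:E)%E ->
  finsupp_fun f -> fsum f = 0 -> dot (M f) (M f) <= c ^+ 2 * dot f f.
Proof.
move=> c0 rc fF f0; have [d0|dn0] := eqVneq (dot f f) 0.
  rewrite d0 mulr0 (dot_eq0 fF d0) markov0.
  by rewrite /dot /fsum fsbig1// => x _; rewrite mulr0.
have dp : 0 < dot f f by rewrite lt_def dn0 dot_ge0.
set t := (Num.sqrt (dot f f))^-1.
have t2 : t ^+ 2 * dot f f = 1 by rewrite exprVn sqr_sqrtr ?dot_ge0// mulVf.
pose g := fun x => t * f x.
have gF : finsupp_fun g by apply: finsuppMr.
have g1 : (l2norm g <= 1)%E by apply/l2norm_finsupp_leP; rewrite // dotZ t2 expr1n.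
have : (l2norm (M g) <= c%:E)%E.
  apply: le_trans rc; apply: ereal_sup_ubound; exists g => //; split => //.
  split; last by rewrite -[LHS]/(fsum g) fsumZ f0 mulr0.
  by rewrite /l2 /=; apply: le_lt_trans g1 _; rewrite ltry.
move=> /(l2norm_finsupp_leP c0 (finsupp_markov gF)).
rewrite markovZ dotZ -(@ler_pM2r _ (dot f f))//.
by rewrite mulrAC t2 mul1r.
Qed.

Lemma iter_markov_l2_0_le c f j : 0 <= c -> (rho0 R (Sch H S) <= c%:E)%E ->
  finsupp_fun f -> fsum f = 0 ->
  dot (iter j M f) (iter j M f) <= (c ^+ 2) ^+ j * dot f f.
Proof.
move=> c0 rc fF f0.
have f0j k : fsum (iter k M f) = 0.
  by elim: k => //= k; apply: fsum_markov_eq0; exact: finsupp_iter_markov.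
elim: j => [|j IHj]; first by rewrite expr0 mul1r.
rewrite iterS exprS -mulrA.
apply: le_trans (ler_wpM2l (sqr_ge0 c) IHj).
by apply: markov_l2_0_le => //; exact: finsupp_iter_markov.
Qed.

(** Each finite partial sum of |M f|^2 is unchanged when f is truncated to a suitable finite set,
    and truncation does not increase the norm. *)
Lemma rho_le c : 0 <= c ->
  (forall f, finsupp_fun f -> dot (M f) (M f) <= c ^+ 2 * dot f f) ->
  (rho R (Sch H S) <= c%:E)%E.
Proof.
move=> c0 Mc; apply: ge_ereal_sup => _ [f [_ f1] <-].
apply/l2norm_leP => // A.
(* On A, the function M f depends only on the values of f on B. *)
pose B := [fset coset_step x s | x in A, s in S]%fset.
pose g := fun x => f x * (x \in B)%:R.
have gB : supported B g by move=> x /negbTE xB; rewrite /g xB mulr0.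
have gF : finsupp_fun g by exists B.
have -> : \sum_(x <- A) M f x ^+ 2 = \sum_(x <- A) M g x ^+ 2.
  apply: eq_big_seq => x xA; congr (_ ^+ 2); rewrite /markov; congr (_ * _).
  apply: eq_big_seq => s sS; rewrite /g.
  suff -> : target x s \in B by rewrite mulr1.
  by apply/imfset2P; exists x => //; exists s.
have /l2norm_leP : (l2norm (M g) <= c%:E)%E; last exact.
apply/l2norm_finsupp_leP => //; first exact: finsupp_markov.
apply: le_trans (Mc _ gF) _.
rewrite -[leRHS]mulr1 ler_wpM2l ?sqr_ge0// (dotE _ gB).
have /(l2norm_leP f ler01)/(_ B) : (l2norm f <= 1%:E)%E by [].
rewrite expr1n; apply: le_trans.
rewrite le_eqVlt; apply/orP; left; apply/eqP; apply: eq_big_seq => x xB.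
by rewrite /g xB mulr1.
Qed.

(** A nonzero value at y requires a walk of length j from y to x; retracing from x, there are at
    most |S|^j such y. *)
Lemma iter_markov_delta_support j x : exists A,
  (#|` A| <= #|` S| ^ j)%N /\ supported A (iter j M (delta R x)).
Proof.
elim: j => [|j [A [cA sA]]].
  exists [fset x]%fset; rewrite cardfs1; split => //; exact: supported_delta.
pose B := seq_fset tt [seq coset_step y (s^-1)%g | y <- A, s <- S].
exists B; split.
  rewrite size_seq_fset (leq_trans (size_undup _))// size_allpairs expnS mulnC.
  by rewrite leq_mul.
move=> y yB; rewrite iterS /markov big_seq big1 ?mulr0// => s sS.
apply: sA; apply: contraNN yB => yA; rewrite seq_fsetE; apply/allpairsP.
by exists (coset_step y s, s); split => //=; rewrite coset_stepK.
Qed.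

(** Pigeonhole: x and the at most |S|^j vertices of the support do not exhaust the graph. The extra
    1 pays for x itself, which makes y differ from x. *)
Lemma exists_far_vertices j : finite_index H ->
  ((#|` S| ^ j).+1 < subgroup_index H)%N ->
  exists x y, x != y /\ iter j M (delta R x) y = 0.
Proof.
move=> Hfin Hj.
have x : V by exists (rtranslate H 1%g); apply/mem_set; exists 1%g.
have [A [cA sA]] := iter_markov_delta_support j x.
have [[y yxA]|noy] := pselect (exists y, y \notin (x |` A)%fset).
  move: yxA; rewrite in_fset1U negb_or => /andP[yx yA].
  by exists x, y; rewrite eq_sym yx sA.
suff : (subgroup_index H <= (#|` S| ^ j).+1)%N by rewrite leqNgt Hj.
apply: leq_trans (_ : #|` x |` A|%fset <= _)%N; last first.
  by rewrite cardfsU1 -add1n leq_add// leq_b1.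
rewrite /subgroup_index.
apply: leq_trans (_ : #|` [fset val z | z in (x |` A)%fset]%fset| <= _)%N; last first.
  exact: leq_imfset_card.
apply: fsubset_leq_card; apply/fsubsetP => K; rewrite in_fset_set// => KH.
apply/imfsetP; exists (exist _ K KH) => //=.
by apply/negPn/negP => yxA; apply: noy; eexists; exact: yxA.
Qed.

(** * Self-adjointness, and return probabilities against norms *)

Hypothesis S_sym : symmetric_set S.

(** The adjoint of the step by s is the step by s^-1, and summing over the symmetric set S absorbs
    the inversion. *)
Lemma dot_markov f g : finsupp_fun f -> dot (M f) g = dot f (M g).
Proof.
move=> fF; rewrite /dot /markov.
under [in LHS]eq_fun do rewrite -mulrA mulr_suml.
under [in RHS]eq_fun do rewrite mulrCA mulr_sumr.
rewrite !fsumZ; congr (_ * _).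
rewrite !fsum_sum => [|s|s]; [|exact: finsuppMl|]; last first.
  by apply: finsuppMl; exact: finsupp_step.
have -> : \sum_(s <- S) fsum (fun x => f x * g (target x s)) =
    \sum_(s <- S) fsum (fun x => f x * g (target x (s^-1)%g)).
  rewrite -(big_map (fun s => (s^-1)%g) xpredT
    (fun s => fsum (fun x => f x * g (target x s)))).
  apply: perm_big; apply: uniq_perm => //.
    by rewrite map_inj_uniq ?fset_uniq//; exact: invg_inj.
  move=> s; apply/idP/mapP => [sS|[u uS ->]]; last exact: S_sym.
  by exists (s^-1)%g; rewrite ?invgK//; exact: S_sym.
apply: eq_bigr => s _; rewrite -(fsum_step _ (s^-1)%g).
by congr fsum; apply/funext => x /=; rewrite coset_stepVK.
Qed.

Lemma dot_iter_markov j f g : finsupp_fun f ->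
  dot (iter j M f) g = dot f (iter j M g).
Proof.
move=> fF; elim: j g => //= j IHj g.
by rewrite dot_markov ?IHj -?iterSr//; exact: finsupp_iter_markov.
Qed.

Lemma dot_iter_markov_delta j x :
  dot (iter j M (delta R x)) (iter j M (delta R x)) =
  iter (j + j) M (delta R x) x.
Proof. by rewrite dot_iter_markov ?dot_delta ?iterD//; exact: finsupp_delta. Qed.

Lemma iter_markov_deltaC j x y :
  iter j M (delta R x) y = iter j M (delta R y) x.
Proof.
have [Dx Dy] := (finsupp_delta R x, finsupp_delta R y).
by rewrite -(dot_delta y) -dot_iter_markov// dotC dot_delta.
Qed.

(** For v = d_x - d_y with x, y far apart the cross terms of |M^j v|^2 vanish, so the two return
    probabilities add up to at most 2 c^(2j). One of them is at most c^(2j), but which one is not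
    known. *)
Lemma iter_markov_delta_rho0 c j : 0 <= c ->
  (rho0 R (Sch H S) <= c%:E)%E -> finite_index H ->
  ((#|` S| ^ (j + j)).+1 < subgroup_index H)%N ->
  exists x, iter (j + j) M (delta R x) x <= (c ^+ 2) ^+ j.
Proof.
move=> c0 rc Hfin /(exists_far_vertices Hfin)[x [y [xy far]]].
have [Dx Dy] := (finsupp_delta R x, finsupp_delta R y).
pose v := fun z => delta R x z - delta R y z.
have vF : finsupp_fun v.
  by apply: finsuppD => //; have [A dA] := Dy; exists A => z /dA ->; rewrite oppr0.
have v0 : fsum v = 0.
  have -> : v = fun z => delta R x z + (-1) * delta R y z.
    by apply/funext => z; rewrite mulN1r.
  rewrite fsumD ?fsumZ ?fsum_delta ?mulN1r ?subrr//; exact: finsuppMr.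
have Mv : dot (iter j M v) (iter j M v) =
    iter (j + j) M (delta R x) x + iter (j + j) M (delta R y) y.
  rewrite dot_iter_markov// -iterD iter_markovB dotBl// !dot_delta.
  by rewrite far -iter_markov_deltaC far subr0 sub0r opprK.
have vv : dot v v = 2.
  rewrite dotBl// !dot_delta /v /delta !eqxx [y == x]eq_sym (negbTE xy).
  by rewrite subr0 sub0r opprK.
have := iter_markov_l2_0_le j c0 rc vF v0; rewrite Mv vv => le2.
have [le_c|lt_c] := leP (iter (j + j) M (delta R x) x) ((c ^+ 2) ^+ j).
  by exists x.
by exists y; move: le2 lt_c; lra.
Qed.

Lemma rho_le_of_return c : 0 <= c ->
  (forall j x, iter (j + j) M (delta R x) x <= (c ^+ 2) ^+ j) ->
  (rho R (Sch H S) <= c%:E)%E.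
Proof.
move=> c0 ret; apply: rho_le => // f fF; have [A fA] := fF.
pose a j := dot (iter j M f) (iter j M f).
have Ff j : finsupp_fun (iter j M f) by exact: finsupp_iter_markov.
(* Self-adjointness moves one M across the inner product; Cauchy-Schwarz then gives
   log-convexity. *)
have alc j : a j.+1 ^+ 2 <= a j * a j.+2.
  have -> : a j.+1 = dot (iter j M f) (iter j.+2 M f).
    by rewrite /a !iterS dot_markov.
  exact: dot_CauchySchwarz.
have a_ge0 j : 0 <= a j by exact: dot_ge0.
(* Expand f in deltas over A. Cauchy-Schwarz against the constant 1 costs the factor |A|, and |M^j
   d_y|^2 is the return probability at y after 2j steps. *)
have aC j : a j <= #|` A|%:R * a 0%N * (c ^+ 2) ^+ j.
  have fE : f = fun x => \sum_(y <- A) f y * delta R y x.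
    apply/funext => x; have [xA|xA] := boolP (x \in A); last first.
      rewrite fA// big_seq big1// => y yA; rewrite /delta.
      by case: eqP => [xy|]; [rewrite xy yA in xA|rewrite mulr0].
    rewrite (big_fsetD1 x)//= /delta eqxx mulr1 big_seq big1 ?addr0// => y.
    by rewrite in_fsetD1 => /andP[yx _]; rewrite eq_sym (negbTE yx) mulr0.
  have iE : iter j M f =
      fun x => \sum_(y <- A) f y * iter j M (delta R y) x.
    rewrite {1}fE; elim: (j) => //= k ->; rewrite markov_sum.
    by apply/funext => x; apply: eq_bigr => y _; rewrite markovZ.
  have sq x : iter j M f x * iter j M f x <= #|` A|%:R *
      \sum_(y <- A) (f y * iter j M (delta R y) x) ^+ 2.
    rewrite iE -expr2.
    have := sqr_sum_le A (fun=> 1) (fun y => f y * iter j M (delta R y) x).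
    under eq_bigr do rewrite mul1r; under [X in _ <= X * _]eq_bigr do rewrite mul1r.
    by rewrite big_const_seq count_predT iter_addr_0.
  have Kf y : finsupp_fun (iter j M (delta R y)).
    by apply: finsupp_iter_markov; exact: finsupp_delta.
  have sqF y : finsupp_fun (fun x => (f y * iter j M (delta R y) x) ^+ 2).
    by apply: finsuppMl; exact: finsuppMr.
  apply: le_trans (ler_fsum (finsuppMl _ (Ff j)) _ sq) _.
    by apply: finsuppMr; exact: finsupp_sum.
  rewrite fsumZ fsum_sum// -mulrA ler_wpM2l//.
  rewrite /a (dotE _ fA) mulr_suml; apply: ler_sum => y _.
  under eq_fun do rewrite expr2.
  by rewrite -/(dot _ _) dotZ expr2 ler_wpM2l -?expr2 ?sqr_ge0// dot_iter_markov_delta.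
have [a0|a0] := eqVneq (a 0%N) 0.
  suff -> : f = fun=> 0.
    by rewrite markov0 /dot /fsum fsbig1 ?mulr0// => x _; rewrite mulr0.
  exact: dot_eq0.
have a0_gt0 : 0 < a 0%N by rewrite lt_def a0 a_ge0.
rewrite -/(a 1%N) -/(a 0%N) -ler_pdivrMr//.
(* Log-convexity gives (a 1 / a 0) ^ j <= a j / a 0 <= |A| * c ^ (2 j). *)
apply: (@le_of_exp_le _ #|` A|%:R) => //; first exact: sqr_ge0.
move=> j; rewrite expr_div_n ler_pdivrMr ?exprn_gt0//.
rewrite -(ler_pM2r a0_gt0).
apply: le_trans (log_convex_exp_le a_ge0 alc j) _.
apply: le_trans (ler_wpM2r (exprn_ge0 j (a_ge0 0%N)) (aC j)) _.
by rewrite le_eqVlt; apply/orP; left; apply/eqP; ring.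
Qed.

End SchreierGraph.

(** * Return probabilities under coverings *)

Section Covering.
Variables (R : realType) (L : choiceType) (X Y : labelled_graph L).
Variable phi : vertex X -> vertex Y.
Hypothesis labelsE : labels X = labels Y.
Hypothesis phi_target : forall x s, phi (target x s) = target (phi x) s.

Lemma iter_markov_cover j (f : vertex X -> R) (g : vertex Y -> R) :
  (forall x, f x <= g (phi x)) ->
  forall x, iter j (@markov R L X) f x <= iter j (@markov R L Y) g (phi x).
Proof.
move=> fg; elim: j => //= j IHj x.
rewrite {1 3}/markov labelsE ler_wpM2l ?invr_ge0//.
by apply: ler_sum => s _; rewrite -phi_target.
Qed.

(** Closed walks at x project to closed walks at [phi x], while a closed walk below may lift to an
    open one; hence only an inequality. *)
Lemma iter_markov_delta_cover j (x : vertex X) :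
  iter j (@markov R L X) (delta R x) x <=
  iter j (@markov R L Y) (delta R (phi x)) (phi x).
Proof.
apply: iter_markov_cover => z; rewrite /delta.
by case: eqP => [->|_]; rewrite ?eqxx.
Qed.

End Covering.

Section CayleyCovering.
Variables (G : groupType) (S : {fset G}) (H : set G).

(** Vertices of the Cayley graph are singletons {a}, and this is the coset y g^-1 a, written so that
    no representative is chosen. It sends {g} to y, and right multiplication commutes with it. *)
Definition coset_mul (y : right_cosets H) (g : G)
    (x : right_cosets [set (1%g : G)]) : set G :=
  [set (u * (g^-1 * a))%g | u in val y & a in val x].

Fact coset_mul_subproof y g x : coset_mul y g x \in right_cosets H.
Proof.
have [/set_mem[h _ yE] /set_mem[a _ xE]] := (valP y, valP x).
apply/mem_set; exists (h * (g^-1 * a))%g => //; rewrite /coset_mul -yE -xE.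
apply/seteqP; split => [_ [k Hk <-]|_ [_ [k Hk <-] [_ [_ -> <-] <-]]] /=.
  exists (k * h)%g; first by exists k.
  by exists a; [exists 1%g => //; rewrite mul1g|rewrite !mulgA].
by exists k => //; rewrite mul1g !mulgA.
Qed.

Lemma exists_covering (x : vertex (Cay S)) (y : vertex (Sch H S)) :
  exists2 phi : vertex (Cay S) -> vertex (Sch H S),
    phi x = y & forall z s, phi (target z s) = target (phi z) s.
Proof.
have [_ /set_mem[g _ /esym xE]] := (val x, valP x).
exists (fun z => exist _ (coset_mul y g z) (coset_mul_subproof y g z)).
  apply/val_inj/seteqP; split => /= [t [u yu [a]]|u yu].
    by rewrite xE => -[_ -> <-] <-; rewrite mul1g mulVg mulg1.
  exists u => //; exists g; last by rewrite mulVg mulg1.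
  by rewrite xE; exists 1%g; rewrite ?mul1g.
move=> z s; apply/val_inj/seteqP; split => /= [_ [u yu [_ [a za <-] <-]]|].
  by exists (u * (g^-1 * a))%g; [exists u => //; exists a|rewrite !mulgA].
move=> _ [_ [u yu [a za <-]] <-].
by exists u => //; exists (a * s)%g; [exists a|rewrite !mulgA].
Qed.

End CayleyCovering.

(** * Passage to the lower limit *)

Lemma limn_einf_lt_frequently (R : realType) (u : (\bar R)^nat) (c : \bar R) N :
  (limn_einf u < c)%E -> exists2 n, (N <= n)%N & (u n < c)%E.
Proof.
move=> uc; have : (einfs u N < c)%E.
  apply: le_lt_trans uc; rewrite limn_einf_lim.
  by rewrite (cvg_lim _ (@cvg_einfs_sup _ u))//; apply: ereal_sup_ubound; exists N.
by move=> /ereal_inf_lt[_ [n /= Nn <-] unc]; exists n.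
Qed.

Lemma opnorm_ge0 (R : realType) (V : choiceType) (E : set (V -> R)) T :
  E (fun=> 0) -> (0 <= opnorm E T)%E.
Proof.
move=> E0; apply: (@le_trans _ _ (l2norm (T (fun=> 0)))).
  exact: poweR_ge0.
apply: ereal_sup_ubound; exists (fun=> 0) => //; split => //.
by apply/l2norm_leP => // A; rewrite big1 ?expr1n// => x _; rewrite expr0n.
Qed.

Theorem proposition4 (R : realType) (Gamma : groupType) (S : {fset Gamma})
    (H : nat -> set Gamma)
    (Gamma_infinite : infinite_set [set: Gamma])
    (S_symmetric : symmetric_set S)
    (S_generates : generated_by S)
    (H_subgroup : forall n, subgroup (H n))
    (H_finite_index : forall n, finite_index (H n))
    (H_index : subgroup_index (H n) @[n --> \oo] --> \oo) :
  (rho R (Cay S) <= limn_einf (fun n => rho0 R (Sch (H n) S)))%E.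
Proof.
have rho0_ge0 n : (0 <= rho0 R (Sch (H n) S))%E.
  apply: opnorm_ge0; split; last by rewrite fsbig1.
  rewrite /l2 /=; apply: le_lt_trans (ltry 0).
  by apply/l2norm_leP => // A; rewrite big1// => x _; rewrite expr0n.
have lim_ge0 : (0 <= limn_einf (fun n => rho0 R (Sch (H n) S)))%E.
  rewrite leNgt; apply/negP => /(limn_einf_lt_frequently 0)[n _].
  by rewrite ltNge rho0_ge0.
(* It suffices to treat real c above the lower limit: [lim_ge0] excludes -oo, and +oo is trivial. *)
suff lim_le c : (limn_einf (fun n => rho0 R (Sch (H n) S)) < c%:E)%E ->
    (rho R (Cay S) <= c%:E)%E.
  case: limn_einf lim_ge0 lim_le => [l| |]// _ lim_le; last exact: leey.
  by apply/lee_addgt0Pr => e e0; apply: lim_le; rewrite lte_fin ltrDl.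
move=> c_lim; have c0 : 0 <= c.
  have [n _ nc] := limn_einf_lt_frequently 0 c_lim.
  by rewrite -lee_fin ltW// (le_lt_trans _ nc).
apply: rho_le_of_return => // j x.
(* The second successor encodes the strict inequality required by [iter_markov_delta_rho0]. *)
pose m := (#|` S| ^ (j + j)).+2.
have [N _ HN] : \forall n \near \oo, (m <= subgroup_index (H n))%N.
  by move/cvgnyPge : H_index; apply.
have [n Nn nc] := limn_einf_lt_frequently N c_lim.
have [y yc] := iter_markov_delta_rho0 S_symmetric c0 (ltW nc) (H_finite_index n) (HN n Nn).
have [phi phi_x phi_target] := exists_covering x y.
apply: le_trans yc; rewrite -phi_x.
exact: iter_markov_delta_cover.
Qed.
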